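(* Let $K\subset\mathbb{C}$ be a finitely Suslinian compactum. If the sequence $R_1,R_2,\ldots$ of components of $\mathbb{C}\setminus K$ is infinite, then the sequence of their diameters converges to zero.
   Context: A compactum is a compact metric space; a continuum is a connected compactum. A compactum is finitely Suslinian if every collection of pairwise disjoint subcontinua whose diameters are bounded away from zero is finite. (The unbounded component of $\mathbb{C}\setminus K$ has infinite diameter; convergence of the diameters to zero means that for every $\varepsilon>0$ all but finitely many of the $R_i$ have diameter less than $\varepsilon$.) *)

(* Defs.v *)
From HB Require Import structures.
From mathcomp Require Import all_boot all_order all_algebra complex.
From mathcomp Require Import all_classical all_reals all_analysis.

Set Implicit Arguments.
Unset Strict Implicit.
Unset Printing Implicit Defensive.

Import Order.TTheory GRing.Theory Num.Theory.
Import numFieldNormedType.Exports.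

Local Open Scope classical_set_scope.
Local Open Scope ring_scope.

(* The complex numbers over [R]. The regular-module wrapper [^o] is what carries
   the topology, which is the one of the balls of the modulus. *)
Notation cplx R := ((R[i])^o) (only parsing).

(* [`|z|] is the modulus of [z] seen as an element of [R[i]]; [normc z] is the
   same number as an element of [R]. The supremum is taken in [\bar R], so that
   unbounded sets have diameter [+oo]; the empty set gets [-oo]. *)
Definition diam (R : realType) (A : set (cplx R)) : \bar R :=
  ereal_sup [set (Normc.normc (p.1 - p.2))%:E | p in A `*` A].

Definition continuum (R : realType) (A : set (cplx R)) : Prop :=
  compact A /\ connected A.

(* A collection of subcontinua is a set of sets. Whether the empty set counts
   as a continuum is immaterial, since it never satisfies the lower bound on the
   diameter. *)
Definition finitely_suslinian (R : realType) (K : set (cplx R)) : Prop :=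
  compact K /\
  forall F : set (set (cplx R)),
    (forall A, F A -> A `<=` K /\ continuum A) ->
    trivIset F id ->
    (exists2 e : R, 0 < e & forall A, F A -> (e%:E <= diam A)%E) ->
    finite_set F.

Definition components (T : topologicalType) (A : set T) : set (set T) :=
  [set connected_component A x | x in A].

(* Main.v *)
Require Import Defs.
From HB Require Import structures.
From mathcomp Require Import all_boot all_order all_algebra complex.
From mathcomp Require Import all_classical all_reals all_analysis.
From mathcomp Require Import ring lra.

(** Only one component of the complement of [K] is unbounded. Suppose that
infinitely many bounded components of diameter at least [e] remain. Cut the
plane into parallel strips [a <= l <= b] much thinner than [e], where [l] is
the real or the imaginary part. Finitely many strips meet the region where the
bounded components lie, so one strip is crossed by infinitely many of them.
The components of [K] inside this strip that join its two sides are pairwise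
disjoint continua of diameter at least [b - a], so there is a finite number
[N] of them. The heart of the proof, [crossing_bound], is that [N + 1] bounded
components of the complement cannot all cross the strip.

To see this, choose in each crossing component [V i] a point [p i] beyond the
side [l = b] and a point [q i] beyond the side [l = a]. A continuous argument
of [z - p i] exists on the part of [K] where [l z <= b], because this part lies
in a half-plane off [p i]. Likewise [z - q i] has one where [a <= l z], and
[(z - p i) / (z - q i)] has one on all of [K], because [p i] can be moved to
[q i] without meeting [K] ([has_arg_component]). So [z - p i] has a continuous
argument on each of the two parts of [K]. On the overlap, which is the part of
[K] in the strip, the two arguments differ by [2 pi] times an integer, which is
constant on each component of the overlap. An integral relation between
[N + 1] vectors of [N] such integers, with coefficients [k i] that are not all
even ([int_relation]), makes the two arguments of
[\prod_i (z - p i) ^ k i] agree on every continuum that joins the sides. The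
rest of the overlap is cut into a closed piece off one side and a closed piece
off the other ([compact_component_split]), and the two arguments can be glued
to a continuous argument of the product on [K] ([has_arg_glue_strip]).

This is impossible: if the product has a continuous argument on [K], then every
[k i] is even ([even_exponent]). Extend the argument to the plane by Tietze's
theorem. Dividing it out of the direction of the other factors inside [V i],
and taking the inverse direction of [(z - p i) ^ k i] outside, gives a
continuous map of the plane to nonzero numbers ([even_order]). On a large circle
it agrees with an odd function when [k i] is odd; contracting the circle
provides that function with a continuous argument, and an odd function on
a circle has none ([odd_has_no_arg]).

In other words, this is the Mayer-Vietoris sequence for the first cohomology of
[K], with classes of maps to the nonzero numbers in place of cocycles. *)

Set Implicit Arguments.
Unset Strict Implicit.
Unset Printing Implicit Defensive.

Import Order.TTheory GRing.Theory Num.Theory.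
Import numFieldNormedType.Exports.

Local Open Scope classical_set_scope.
Local Open Scope ring_scope.
Local Open Scope complex_scope.

Section plane.
Context {R : realType}.
Local Notation C := (cplx R).
Local Notation Re := (@complex.Re R).
Local Notation Im := (@complex.Im R).

(** * Coordinates and limits in the complex plane *)

Lemma normcE (z : C) : `|z| = (Normc.normc z)%:C.
Proof. by []. Qed.

Lemma Re_le_normc (z : C) : `|Re z| <= Normc.normc z.
Proof. by case: z => x y /=; rewrite -sqrtr_sqr ler_wsqrtr// lerDl sqr_ge0. Qed.

Lemma Im_le_normc (z : C) : `|Im z| <= Normc.normc z.
Proof. by case: z => x y /=; rewrite -sqrtr_sqr ler_wsqrtr// lerDr sqr_ge0. Qed.

Lemma normc_le (z : C) : Normc.normc z <= `|Re z| + `|Im z|.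
Proof.
case: z => x y /=; rewrite -(ger0_norm (addr_ge0 (normr_ge0 x) (normr_ge0 y))).
rewrite -sqrtr_sqr ler_wsqrtr// sqrrD !real_normK ?num_real//.
by rewrite addrAC lerDl mulrn_wge0// mulr_ge0.
Qed.

Lemma continuous_Re : continuous (Re : C -> R).
Proof.
move=> z; apply/(cvgrPdist_lt (FF := nbhs_filter z)) => e e0; apply/nbhs_ballP.
exists e%:C => /=; first by rewrite ltcR.
move=> y; rewrite /ball /= normcE ltcR => h.
by apply: le_lt_trans h; rewrite -raddfB; exact: Re_le_normc.
Qed.

Lemma continuous_Im : continuous (Im : C -> R).
Proof.
move=> z; apply/(cvgrPdist_lt (FF := nbhs_filter z)) => e e0; apply/nbhs_ballP.
exists e%:C => /=; first by rewrite ltcR.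
move=> y; rewrite /ball /= normcE ltcR => h.
by apply: le_lt_trans h; rewrite -raddfB; exact: Im_le_normc.
Qed.

Lemma cvg_complex (T : Type) (F : set_system T) {FF : Filter F} (f g : T -> R) a b :
  f @ F --> a -> g @ F --> b ->
  (fun t => f t +i* g t : C) @ F --> (a +i* b : C).
Proof.
move=> fa gb; apply/(@cvgrPdist_lt _ (cplx R)) => e e0.
have [e' e'0 ->] : exists2 e' : R, 0 < e' & e = e'%:C.
  by case: e e0 => x y; rewrite ltcE /= => /andP[/eqP -> x0]; exists x.
have e20 : 0 < e' / 2 by rewrite divr_gt0.
near=> t.
rewrite normcE ltcR (le_lt_trans (normc_le _))//= [ltRHS]splitr ltrD//.
  by near: t; move/cvgrPdist_lt: fa; exact.
by near: t; move/cvgrPdist_lt: gb; exact.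
Unshelve. all: end_near. Qed.

(** The limit laws at the type of complex numbers, where the scalar field and
the normed space are two structures on one type. *)
Section cvgC.
Context {T : Type} {F : set_system T} {FF : Filter F}.
Implicit Types (f g : T -> C) (a b : C).

Lemma ccvg_cst a : (fun _ : T => a) @ F --> a.
Proof. exact: cvg_cst. Qed.

Lemma ccvgB f g a b : f @ F --> a -> g @ F --> b ->
  (fun t => f t - g t : C) @ F --> (a - b : C).
Proof. exact: (@cvgB _ C). Qed.

Lemma ccvgD f g a b : f @ F --> a -> g @ F --> b ->
  (fun t => f t + g t : C) @ F --> (a + b : C).
Proof. exact: (@cvgD _ C). Qed.

Lemma ccvgM f g a b : f @ F --> a -> g @ F --> b ->
  (fun t => f t * g t : C) @ F --> (a * b : C).
Proof. exact: (@cvgM C). Qed.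

Lemma ccvgV f a : a != 0 -> f @ F --> a -> (fun t => (f t)^-1 : C) @ F --> (a^-1 : C).
Proof. exact: (@cvgV C). Qed.

Lemma ccvg_norm f a : f @ F --> a -> (fun t => `|f t| : C) @ F --> (`|a| : C).
Proof. exact: (@cvg_norm _ C). Qed.

End cvgC.

(** The modulus of the plane takes values in the complex numbers, so normality
is transported by the coordinates from [R * R], whose metric is real. *)
Lemma normal_cplx : normal_space C.
Proof.
apply/(@normal_openP R) => A B cA cB AB.
(* [k] and [j] are the inverse homeomorphisms between the plane and [R * R] *)
pose j (z : C) : R * R := (Re z, Im z).
pose k (p : R * R) : C := p.1 +i* p.2.
have kc : continuous k.
  by move=> p; apply: cvg_complex; [exact: cvg_fst|exact: cvg_snd].
have jc : continuous j.
  move=> z; exact: (cvg_pair (FF := nbhs_filter z) (@continuous_Re z) (@continuous_Im z)).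
have jk z : k (j z) = z by case: z.
have [|U [V [oU oV AU BV UV]]] := (@normal_openP R _).1
    (@pseudometric_normal R (R * R)%type) _ _
    (closed_comp (fun p _ => kc p) cA) (closed_comp (fun p _ => kc p) cB).
  by rewrite -preimage_setI AB preimage_set0.
exists (j @^-1` U), (j @^-1` V); split.
- by apply: open_comp => // z _; exact: jc.
- by apply: open_comp => // z _; exact: jc.
- by move=> z Az; apply: AU; rewrite /preimage/= jk.
- by move=> z Az; apply: BV; rewrite /preimage/= jk.
- by rewrite -preimage_setI UV preimage_set0.
Qed.

(** With this, continuity on a compact set can be replaced by continuity on the
whole plane, so that arguments compose without domain conditions. *)
Lemma tietze_compact (X : set C) (f : C -> R) :
  compact X -> {within X, continuous f} ->
  exists g : C -> R, continuous g /\ {in X, f =1 g}.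
Proof.
move=> cX cf.
have clX : closed X by apply: compact_closed cX; exact: norm_hausdorff.
have [M [_ HM]] := compact_bounded (continuous_compact cf cX).
have M0 : 0 < `|M| + 1 by rewrite ltr_wpDl.
have bf z : X z -> `|f z| <= `|M| + 1.
  by move=> Xz; apply: HM; [rewrite ltr_pwDr// ler_norm|exists z].
have [g [fg cg _]] := continuous_bounded_extension normal_cplx clX M0 cf bf.
by exists g.
Qed.

(** * Unimodular numbers and arguments *)

Definition cis (t : R) : C := cos t +i* sin t.

Lemma cis0 : cis 0 = 1. Proof. by rewrite /cis cos0 sin0. Qed.

Lemma cispi : cis pi = -1. Proof. by rewrite /cis cospi sinpi; simpc. Qed.

Lemma cisD s t : cis (s + t) = cis s * cis t :> R[i].
Proof.
rewrite /cis cosD sinD; apply/eqP; rewrite eq_complex /=.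
by rewrite eqxx /= addrC.
Qed.

Lemma norm_cis t : `|cis t| = 1 :> R[i].
Proof. by rewrite normcE /= cos2Dsin2 sqrtr1. Qed.

Lemma cis_neq0 t : cis t != 0 :> R[i].
Proof. by rewrite -normr_eq0 norm_cis oner_eq0. Qed.

Lemma cisN t : cis (- t) = (cis t)^-1 :> R[i].
Proof.
by apply: (mulfI (cis_neq0 t)); rewrite -cisD subrr cis0 mulfV ?cis_neq0.
Qed.

Lemma cisMz t (k : int) : cis (t * k%:~R) = cis t ^ k :> R[i].
Proof.
have H n : cis (t * n%:R) = cis t ^+ n :> R[i].
  elim: n => [|n IH]; first by rewrite mulr0 cis0.
  by rewrite -natr1 mulrDr mulr1 cisD IH exprSr.
case: k => n; first exact: H.
by rewrite NegzE mulrNz mulrN cisN -exprnN H.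
Qed.

Lemma cis_sum I (r : seq I) (P : pred I) (F : I -> R) :
  cis (\sum_(i <- r | P i) F i) = \prod_(i <- r | P i) cis (F i) :> R[i].
Proof. by elim/big_rec2: _ => [|i y x _ <-]; rewrite ?cis0 ?cisD. Qed.

Lemma continuous_cis : continuous cis.
Proof.
move=> t; apply: cvg_complex; [exact: continuous_cos|exact: continuous_sin].
Qed.

(** Subtracting a multiple of the period leaves a number in [[0, 2 pi[], and
the cosine takes the value 1 only at 0 there. *)
Lemma cis_eq1 t : cis t = 1 -> exists k : int, t = k%:~R * (pi *+ 2).
Proof.
move=> ct1; pose k := Num.floor (t / (pi *+ 2)).
have p0 : 0 < pi *+ 2 :> R by rewrite mulrn_wgt0// pi_gt0.
exists k; apply/eqP; rewrite -subr_eq0; set r := _ - _.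
have cr : cis r = 1.
  rewrite /r mulrC -mulNr cisD cisMz cisN ct1 /cis cos2pi sin2pi.
  by rewrite -[1 +i* 0]/(1 : R[i]) invr1 exp1rz mulr1.
have /andP[r0 r1] : 0 <= r < pi *+ 2.
  rewrite subr_ge0 -ler_pdivlMr// Num.Theory.floor_le /=.
  by rewrite ltrBlDl -[X in _ + X]mul1r -mulrDl -ltr_pdivrMr// -intrD1 floorD1_gt.
have [rp|rp] := leP r pi.
  apply/eqP/cos_inj; rewrite ?in_itv/= ?lexx ?pi_ge0 ?r0 ?rp//.
  by move: cr => /(congr1 Re)/= ->; rewrite cos0.
have : pi *+ 2 - r = 0.
  apply/cos_inj; rewrite ?in_itv/= ?lexx ?pi_ge0//.
    by rewrite subr_ge0 ltW//= mulr2n; lra.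
  rewrite -cosN opprB cos0; move: cr => /(congr1 Re)/= <-.
  by rewrite -cosD2pi subrK.
by lra.
Qed.

(** Any number is an argument of 0. *)
Definition arg_of (w : C) (t : R) : Prop := w = `|w| * cis t :> R[i].

Lemma arg_ofM (v w : C) s t :
  arg_of v s -> arg_of w t -> arg_of (v * w : R[i]) (s + t).
Proof.
by rewrite /arg_of => hv hw; rewrite normrM cisD mulrACA -hv -hw.
Qed.

Lemma arg_ofV (w : C) t : arg_of w t -> arg_of (w^-1 : R[i]) (- t).
Proof. by rewrite /arg_of => hw; rewrite normfV cisN -invfM -hw. Qed.

Lemma arg_ofXz (w : C) t (k : int) :
  arg_of w t -> arg_of (w ^ k : R[i]) (t * k%:~R).
Proof.
move=> hw.
have H n : arg_of (w ^+ n : R[i]) (t * n%:R).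
  elim: n => [|n IH]; first by rewrite /arg_of mulr0 cis0 normr1 mulr1.
  by rewrite -natr1 mulrDr mulr1 exprSr; exact: arg_ofM.
case: k => n; first exact: H.
by rewrite NegzE mulrNz mulrN -exprnN; exact: arg_ofV.
Qed.

Lemma arg_of_prod I (r : seq I) (w : I -> C) (t : I -> R) :
  (forall i, arg_of (w i) (t i)) ->
  arg_of (\prod_(i <- r) w i : R[i]) (\sum_(i <- r) t i).
Proof.
rewrite /arg_of => h; rewrite normr_prod cis_sum -big_split /=.
by apply: eq_bigr.
Qed.

Lemma arg_of_uniq (w : C) s t : w != 0 -> arg_of w s -> arg_of w t ->
  exists k : int, s - t = k%:~R * (pi *+ 2).
Proof.
move=> w0 hs ht; apply: cis_eq1; rewrite cisD cisN.
have nw0 : `|w| != 0 :> R[i] by rewrite normr_eq0.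
suff -> : cis s = cis t by rewrite mulfV ?cis_neq0.
by apply: (mulfI nw0); rewrite -hs -ht.
Qed.

Lemma arg_of_right (w : C) : 0 < Re w -> arg_of w (atan (Im w / Re w)).
Proof.
case: w => x y /= x0; rewrite /arg_of normcE /cis /=.
have ct := cos_atan (y / x).
have st : sin (atan (y / x)) = y / x * cos (atan (y / x)).
  rewrite -{2}[y / x]atanK /tan mulfVK// ct invr_eq0 sqrtr_eq0 -ltNge.
  by rewrite ltr_pwDl// sqr_ge0.
have nE : Num.sqrt (x ^+ 2 + y ^+ 2) = x * Num.sqrt (1 + (y / x) ^+ 2).
  rewrite -[X in X * _](ger0_norm (ltW x0)) -sqrtr_sqr -sqrtrM ?sqr_ge0//.
  by congr Num.sqrt; field; rewrite gt_eqF.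
rewrite st ct nE; set q := Num.sqrt _.
have q0 : q != 0 by rewrite gt_eqF// sqrtr_gt0 ltr_pwDl// sqr_ge0.
by apply/eqP; rewrite eq_complex /=; apply/andP; split; apply/eqP; field;
  rewrite ?q0 ?gt_eqF.
Qed.

(** * Functions with a continuous argument *)

(** The argument is defined and continuous on the whole plane, although it is
one of [f z] only for [z] in [X]. For compact [X] this costs nothing, by
[tietze_compact]. *)
Definition has_arg (X : set C) (f : C -> C) : Prop :=
  exists2 theta : C -> R, continuous theta & forall z, X z -> arg_of (f z) (theta z).

Lemma eq_has_arg (X : set C) (f g : C -> C) :
  (forall z, X z -> f z = g z) -> has_arg X f -> has_arg X g.
Proof. by move=> fg [t ct h]; exists t => // z Xz; rewrite -fg//; exact: h. Qed.

Lemma has_argM (X : set C) (f g : C -> C) :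
  has_arg X f -> has_arg X g -> has_arg X (fun z => f z * g z : R[i]).
Proof.
move=> [s cs hs] [t ct ht]; exists (fun z => s z + t z).
  move=> z; exact: (cvgD (FF := nbhs_filter z) (cs z) (ct z)).
by move=> z Xz; apply: arg_ofM; [exact: hs|exact: ht].
Qed.

Lemma has_argV (X : set C) (f : C -> C) :
  has_arg X f -> has_arg X (fun z => (f z)^-1 : R[i]).
Proof.
move=> [s cs hs]; exists (fun z => - s z).
  move=> z; exact: (cvgN (FF := nbhs_filter z) (cs z)).
by move=> z Xz; apply: arg_ofV; exact: hs.
Qed.

Lemma has_arg_right (X : set C) (f : C -> C) :
  compact X -> {within X, continuous f} -> (forall z, X z -> 0 < Re (f z)) ->
  has_arg X f.
Proof.
move=> cX cf pf.
have [|g [cg fg]] := @tietze_compact X (fun z => atan (Im (f z) / Re (f z))) cX.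
  apply: (@within_continuous_comp _ _ _ X f (fun w : C => atan (Im w / Re w)) _ cf).
  move=> _ /set_mem[z Xz <-].
  apply: (@continuous_comp _ _ _ (fun w : C => Im w / Re w)); last first.
    exact: continuous_atan.
  apply: (cvgM (FF := nbhs_filter (f z))); first exact: continuous_Im.
  apply: (cvgV (FF := nbhs_filter (f z))); last exact: continuous_Re.
  by rewrite gt_eqF// pf.
exists g => // z Xz; rewrite -fg ?inE//; apply: arg_of_right; exact: pf.
Qed.

(** The class of a point and its complement are both open in [A]. *)
Lemma connected_rel (T : topologicalType) (A : set T) (r : T -> T -> Prop) :
  connected A -> (forall x, A x -> r x x) ->
  (forall x y, r x y -> r y x) ->
  (forall y x z, A y -> r x y -> r y z -> r x z) ->
  (forall x, A x -> \forall y \near within A (nbhs x), r x y) ->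
  forall x y, A x -> A y -> r x y.
Proof.
move=> cA rr rs rt rl x y Ax Ay; apply: contrapT => nrxy.
apply: ((connectedP A).1 cA) (fun b => if b then A `&` ~` r x else A `&` r x) _.
have far z (B : set T) : A z -> closure B z -> B `<=` A ->
    exists2 w, B w & r z w.
  by move=> Az clB BA; have [w [Bw h]] := clB _ (rl z Az); exists w => //;
    apply: h; exact: BA.
split.
- by case; [exists y|exists x; split=> //; exact: rr].
- by rewrite -setIUr setUv setIT.
- split; rewrite -subset0 => z [].
    move=> /[swap] -[Az nz] /far -/(_ Az)[w []//|w [Aw rw] zw].
    by apply: nz; apply: rt Aw rw _; exact: rs.
  move=> [Az rxz] /far -/(_ Az)[w []//|w [Aw rw] zw].
  by apply: rw; apply: rt Az rxz _.
Qed.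

(** Homotopy invariance: when [a] and [b] are close, the quotient of [F a] and
[F b] is close to 1 uniformly on the compact set [X], hence has positive real
part and the argument given by the arctangent. Connectedness of the parameter
space then multiplies finitely many such quotients. *)
Lemma homotopy_has_arg (T : topologicalType) (A : set T) (X : set C)
    (F : T -> C -> C) (s t : T) :
  connected A -> compact X ->
  (forall a z, A a -> X z -> F a z != 0) ->
  (forall a z, A a -> X z -> {for (a, z), continuous (fun p => F p.1 p.2)}) ->
  A s -> A t -> has_arg X (fun z => F s z / F t z : R[i]).
Proof.
move=> cA cX F0 cF.
have cFa a : A a -> {within X, continuous (F a)}.
  move=> Aa; apply: continuous_in_subspaceT => z; rewrite inE => Xz.
  have h : (fun z => (a, z)) @ z --> (a, z).
    exact: (cvg_pair (FF := nbhs_filter z) (cvg_cst a) cvg_id).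
  exact: (cvg_comp _ _ h (cF a z Aa Xz)).
have cFF a b : A a -> A b -> {within X, continuous (fun z => F a z / F b z : C)}.
  move=> Aa Ab; rewrite continuous_subspace_in => z; rewrite inE => Xz.
  by apply: ccvgM; [exact: cFa|apply: ccvgV; [exact: F0|exact: cFa]].
move: s t.
apply: (connected_rel cA (r := fun s t =>
  has_arg X (fun z => F s z / F t z : R[i]))).
- move=> a Aa; apply: has_arg_right => //; first exact: cFF.
  by move=> z Xz; rewrite divff ?F0// ltr01.
- by move=> a b /has_argV; apply: eq_has_arg => z _; rewrite invf_div.
- move=> b a c Ab hab hbc; have := has_argM hab hbc; apply: eq_has_arg => z Xz.
  by rewrite mulrA divfK// F0.
- move=> a Aa.
  suff : \forall b \near within A (nbhs a),
      X `<=` [set z | A b -> 0 < Re (F a z / F b z : R[i])].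
    apply: filterS2 (withinT A (nbhs_filter a)) => b Ab h.
    apply: has_arg_right => //; first exact: cFF.
    by move=> z Xz; exact: h.
  apply: ((compact_near_coveringP X).1 cX T (within A (nbhs a))
    (fun b z => A b -> 0 < Re (F a z / F b z : R[i]))) => z Xz.
  have h : (fun p : C * T => F a p.1 / F p.2 p.1 : C) @ (z, a) --> (1 : C).
    rewrite -(divff (F0 a z Aa Xz)); apply: ccvgM.
      have hh : (fun p : C * T => (a, p.1)) @ (z, a) --> (a, z).
        exact: (cvg_pair (FF := nbhs_filter ((z : C), a)) (cvg_cst a) cvg_fst).
      exact: (cvg_comp _ _ hh (cF a z Aa Xz)).
    apply: ccvgV; first exact: F0.
    have hh : (fun p : C * T => (p.2, p.1)) @ (z, a) --> (a, z).
      exact: (cvg_pair (FF := nbhs_filter ((z : C), a)) cvg_snd cvg_fst).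
    exact: (cvg_comp _ _ hh (cF a z Aa Xz)).
  have := cvg_comp _ _ h (@continuous_Re (1 : C)).
  move=> /cvgr_gt /(_ 0) /= /(_ ltr01).
  case=> -[B D] /= [zB aD] BD.
  exists (B, D) => /=; first by split=> //; exact: cvg_within.
  by move=> p BDp _; exact: BD.
Qed.

(** * The exponents of a product with a continuous argument *)

(** The difference of the values of an argument at opposite points of the circle
is an odd function, hence vanishes somewhere; there [g] takes the same value at
two opposite points. *)
Lemma odd_has_no_arg (M : R) (g : C -> C) :
  (forall s, 0 <= s <= pi -> g (M%:C * cis s) != 0 /\
     g (M%:C * cis (s + pi)) = - g (M%:C * cis s)) ->
  ~ has_arg [set (M%:C * cis s : C) | s in `[0%R, pi *+ 2]] g.
Proof.
move=> godd [t ct ht].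
(* the increment of the argument under the half turn *)
pose D s := t (M%:C * cis (s + pi)) - t (M%:C * cis s).
have cMcis : continuous (fun s => M%:C * cis s : C).
  by move=> s; apply: ccvgM; [exact: cvg_cst|exact: continuous_cis].
have ctM : continuous (fun s => t (M%:C * cis s)).
  by move=> s; exact: (cvg_comp _ _ (cMcis s) (ct _)).
have cD : continuous D.
  move=> s; apply: cvgB; last exact: ctM.
  have h : (fun s => s + pi) @ s --> s + pi.
    by apply: cvgD; [exact: cvg_id|exact: cvg_cst].
  exact: (cvg_comp _ _ h (ctM _)).
have Dpi : D pi = - D 0.
  rewrite /D add0r opprB; congr (t (_ * _) - _).
  by rewrite cisD cispi cis0 mulN1r opprK.
have [s sI Ds0] : exists2 s, s \in `[0, pi] & D s = 0.
  apply: IVT; first exact: pi_ge0.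
    exact: continuous_subspaceT.
  rewrite Dpi ge_min le_max oppr_ge0 oppr_le0.
  by have [//|/ltW ->] := leP 0 (D 0); rewrite ?orbT.
move: sI; rewrite in_itv /= => sI; have /andP[s0 sp] := sI.
have [gn0 go] := godd _ sI.
have := ht _ (imageP _ (_ : `[0%R, pi *+ 2]%classic s)).
have := ht _ (imageP _ (_ : `[0%R, pi *+ 2]%classic (s + pi))).
rewrite /= !in_itv /= mulr2n lerD// addr_ge0 ?pi_ge0// s0 ler_wpDl ?pi_ge0//.
move=> /(_ isT) + /(_ isT).
rewrite go /arg_of normrN; move/eqP: Ds0; rewrite subr_eq0 => /eqP ->.
move=> <- /eqP; rewrite -addr_eq0 -mulr2n.
by rewrite mulrn_eq0 /= (negPf gn0).
Qed.

Lemma exprz_oddN (x : R[i]) (k : int) : odd `|k|%N -> (- x) ^ k = - (x ^ k).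
Proof.
have H n : odd n -> (- x) ^+ n = - x ^+ n.
  by move=> no; rewrite exprNn -signr_odd no mulN1r.
case: k => n; first exact: H.
by rewrite NegzE abszN => /H h; rewrite -!exprnN h invrN.
Qed.

(** Passing to directions keeps arguments and makes the two formulas that are
glued in [even_order] agree on the boundary, moduli included. *)
Definition dir (w : C) : C := w / `|w| : R[i].

Lemma dirM (v w : C) : dir (v * w : R[i]) = dir v * dir w :> R[i].
Proof. by rewrite /dir normrM invfM mulrACA. Qed.

Lemma dirN (w : C) : dir (- w) = - dir w.
Proof. by rewrite /dir normrN mulNr. Qed.

Lemma dir_neq0 (w : C) : w != 0 -> dir w != 0.
Proof. by move=> w0; rewrite /dir mulf_neq0// invr_eq0 normr_eq0. Qed.

Lemma dirXz (w : C) (k : int) : dir (w ^ k : R[i]) = dir w ^ k :> R[i].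
Proof.
have H n : dir (w ^+ n : R[i]) = dir w ^+ n :> R[i].
  by rewrite /dir normrX -exprVn -exprMn.
case: k => n; first exact: H.
by rewrite NegzE -!exprnN -H /dir normfV invfM.
Qed.

Lemma dir_arg (w : C) t : w != 0 -> arg_of w t -> dir w = cis t.
Proof.
move=> w0 ht; rewrite /dir {1}ht mulrAC mulfV ?mul1r//.
by rewrite normr_eq0.
Qed.

Lemma cvg_dir (T : Type) (F : set_system T) {FF : Filter F} (f : T -> C) (a : C) :
  a != 0 -> f @ F --> a -> (fun t => dir (f t)) @ F --> dir a.
Proof.
move=> a0 fa; apply: (ccvgM fa); apply: ccvgV; last exact: ccvg_norm.
by rewrite normr_eq0.
Qed.

Lemma cvg_exprz (T : Type) (F : set_system T) {FF : Filter F} (f : T -> C)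
    (a : C) (k : int) :
  a != 0 -> f @ F --> a -> (fun t => f t ^ k : C) @ F --> (a ^ k : C).
Proof.
move=> a0 fa.
have H n : (fun t => f t ^+ n : C) @ F --> (a ^+ n : C).
  elim: n => [|n IH]; first exact: cvg_cst.
  under eq_fun do rewrite exprS.
  by rewrite exprS; exact: ccvgM.
case: k => n; first exact: H.
by apply: ccvgV; [exact: expf_neq0|exact: H].
Qed.

(** If [k] is odd, then [u] and the extended argument provide a continuous
nonzero function on the plane that is the inverse direction of [(z - p) ^ k]
outside [V]: the two formulas agree on the boundary of [V]. On a circle around
[p] that encloses [V] it is odd, and it has a continuous argument there because
the circle contracts to [p]. Only [u] sees the other zeros and poles, and they
stay outside the closure of [V]. *)
Lemma even_order (V : set C) (p : C) (k : int) (u : C -> C) (M : R) :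
  open V -> V p -> (forall z, V z -> Normc.normc (z - p) < M) ->
  {within closure V, continuous u} -> (forall z, closure V z -> u z != 0) ->
  has_arg (closure V `\` V) (fun z => (z - p) ^ k * u z : R[i]) ->
  ~~ odd `|k|%N.
Proof.
move=> oV Vp VM cu u0 [t ct ht]; apply/negP => ko.
have zp z : ~ V z -> z - p != 0.
  by apply: contra_notN; rewrite subr_eq0 => /eqP ->.
have cB : closed (~` V) by exact: open_closedC.
(* [Phi1] is used in [V] and [Phi2] outside; they agree on the boundary *)
pose Phi1 z : C := dir (u z) * cis (- t z).
pose Phi2 z : C := (dir (z - p) ^ k)^-1 : R[i].
pose Phi z := if pselect (V z) then Phi1 z else Phi2 z.
have Phi2E z : ~ V z -> Phi z = Phi2 z by rewrite /Phi; case: pselect.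
have Phi1E z : closure V z -> Phi z = Phi1 z.
  rewrite /Phi; case: pselect => // nVz cVz.
  have := dir_arg _ (ht z (conj cVz nVz)).
  rewrite mulf_neq0 ?u0 ?expfz_neq0 ?zp// => /(_ isT).
  rewrite dirM dirXz /Phi1 cisN => <-.
  by rewrite /= /Phi2 invfM mulrCA mulfV ?mulr1// dir_neq0 ?u0.
have cPhi : continuous Phi.
  have -> : Phi = from_subspace setT Phi by [].
  suff : {within closure V `|` ~` V, continuous Phi}.
    have -> : closure V `|` ~` V = setT.
      by apply/seteqP; split=> // z _; have [Vz|] := pselect (V z);
        [left; exact: subset_closure|right].
    by move=> h z; move: (h z); rewrite /continuous_at nbhs_subspaceT.
  apply: withinU_continuous; [exact: closed_closure|by []| |].
    apply: (@subspace_eq_continuous _ _ _ Phi1).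
      by move=> z; rewrite inE => /Phi1E.
    rewrite continuous_subspace_in => z; rewrite inE => Vz.
    apply: ccvgM; first by apply: cvg_dir; [exact: u0|exact: cu].
    apply: (continuous_subspaceT (f := fun z => cis (- t z))) => x.
    have h : (fun z => - t z) @ x --> - t x.
      exact: (cvgN (FF := nbhs_filter x) (ct x)).
    exact: (cvg_comp _ _ h (@continuous_cis _)).
  apply: (@subspace_eq_continuous _ _ _ Phi2).
    by move=> z; rewrite inE => /Phi2E.
  apply: continuous_in_subspaceT => z; rewrite inE => /zp z0.
  have d0 : (dir (z - p) : R[i]) != 0 by exact: dir_neq0.
  have h1 : (fun z => z - p : C) @ z --> (z - p : C).
    exact: (ccvgB (FF := nbhs_filter z) cvg_id (cvg_cst p)).
  have h4 : (dir (z - p) ^ k : C) != 0 by exact: expfz_neq0.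
  exact: (ccvgV h4 (cvg_exprz d0 (cvg_dir z0 h1))).
have Phi0 z : Phi z != 0.
  have [Vz|nVz] := pselect (V z).
    have cVz := subset_closure Vz.
    by rewrite Phi1E// mulf_neq0 ?cis_neq0// dir_neq0 ?u0.
  by rewrite Phi2E// invr_eq0 expfz_neq0 ?dir_neq0 ?zp.
have M0 : 0 < M by have := VM _ Vp; rewrite subrr Normc.normc0.
have sV s : ~ V (p + M%:C * cis s : C).
  move=> /VM; rewrite addrC addKr Normc.normcM.
  have -> : Normc.normc (cis s) = 1 by rewrite /= cos2Dsin2 sqrtr1.
  by rewrite mulr1 /= expr0n addr0 sqrtr_sqr gtr0_norm// ltxx.
pose S : set C := [set (M%:C * cis s : C) | s in `[0%R, pi *+ 2]].
have cS : compact S.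
  apply: continuous_compact; last exact: segment_compact.
  apply: continuous_subspaceT => s.
  by apply: ccvgM; [exact: cvg_cst|exact: continuous_cis].
(* the circle shrinks to [p] as [s] goes from 1 to 0 *)
pose F (s : R) (w : C) := Phi (p + s%:C * w : C).
have : has_arg S (fun z => F 1 z / F 0 z : R[i]).
  have cT : connected [set: R] by apply/connected_intervalP.
  apply: (@homotopy_has_arg R setT S F 1 0 cT cS _ _ I I).
    by move=> *; exact: Phi0.
  move=> a z _ _.
  have h1 : (fun q : R * C => q.1%:C : C) @ (a, z) --> (a%:C : C).
    exact: (cvg_complex (FF := nbhs_filter (a, z)) cvg_fst (cvg_cst 0)).
  have hs : (fun q : R * C => q.2) @ (a, z) --> z by exact: cvg_snd.
  have h2 := ccvgM (FF := nbhs_filter (a, z)) h1 hs.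
  have hp : (fun q : R * C => p) @ (a, z) --> p by exact: cvg_cst.
  have h3 := ccvgD (FF := nbhs_filter (a, z)) hp h2.
  have h4 := cvg_comp _ _ h3 (cPhi (p + a%:C * z : C)).
  rewrite /prop_for /continuous_at /=; exact: h4.
apply: odd_has_no_arg => s _; rewrite /F !mul1r !mul0r !addr0; split.
  by rewrite mulf_neq0// invr_eq0.
rewrite -mulNr; congr (_ / _).
rewrite !Phi2E// /Phi2 cisD cispi mulrN1 mulrN.
have pK (x : C) : p + x - p = x by rewrite addrC addKr.
rewrite !pK.
by rewrite dirN exprz_oddN// invrN.
Qed.

(** * Separating the components of a compact set *)

(** Otherwise the sets [A i] minus [W] generate a proper filter on [Y], and a
cluster point of it lies in every [A i] but not in [W]. *)
Lemma compact_directed (T : topologicalType) (Y : set T) (I : Type)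
    (P : set I) (A : I -> set T) (W : set T) :
  compact Y -> P !=set0 -> (forall i, P i -> closed (A i) /\ A i `<=` Y) ->
  (forall i j, P i -> P j -> exists2 k, P k & A k `<=` A i `&` A j) ->
  open W -> \bigcap_(i in P) A i `<=` W ->
  exists2 i, P i & A i `<=` W.
Proof.
move=> cY [i0 Pi0] cA dA oW AW; apply: contrapT => noA.
pose F := filter_from P (fun i => A i `\` W).
have FF : ProperFilter F.
  apply: filter_from_proper; last first.
    move=> i Pi; apply: contrapT => /nonemptyPn; rewrite setD_eq0 => AiW.
    by apply: noA; exists i.
  apply: filter_from_filter; first by exists i0.
  move=> i j Pi Pj; have [k Pk kij] := dA i j Pi Pj; exists k => // x [Akx nWx].
  by have [] := kij x Akx.
have [|x [Yx Fx]] := cY F FF.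
  by exists i0 => // x [/(cA i0 Pi0).2].
have AWx i : P i -> (A i `\` W) x.
  move=> Pi; have cAW : closed (A i `\` W).
    by rewrite setDE; apply: closedI; [exact: (cA i Pi).1|exact: open_closedC].
  by rewrite ((closure_id _).1 cAW) => B Bx; apply: Fx => //; exists i.
have [_ nWx] := AWx i0 Pi0; apply: nWx; apply: AW => i Pi.
by have [] := AWx i Pi.
Qed.

(** In a compact Hausdorff space the component of a point is the intersection of the
clopen sets around it. So each point of [A] has a clopen neighbourhood off [B],
and finitely many of these cover [A] by compactness. *)
Lemma compact_component_split (T : topologicalType) (Y A B : set T) :
  hausdorff_space T -> normal_space T -> compact Y -> closed A -> closed B ->
  (forall x, Y x -> A x -> connected_component Y x `&` B = set0) ->
  exists Y1 Y2 : set T, [/\ closed Y1, closed Y2, Y1 `|` Y2 = Y,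
    Y1 `&` Y2 = set0 & (Y `&` A `<=` Y1) /\ (Y `&` B `<=` Y2)].
Proof.
move=> hT nT cY cA cB AB; have clY := compact_closed hT cY.
have no (S : set T) x : S = set0 -> ~ S x by move=> ->.
(* the relatively clopen subsets of [Y] *)
pose clp D := [/\ D `<=` Y, closed D & closed (Y `\` D)].
have clpI D E : clp D -> clp E -> clp (D `&` E).
  move=> [DY cD cYD] [EY cE cYE]; split.
  - by move=> x [/DY].
  - exact: closedI.
  - by rewrite setDIr; exact: closedU.
have clpU D E : clp D -> clp E -> clp (D `|` E).
  move=> [DY cD cYD] [EY cE cYE]; split.
  - by move=> x [/DY|/EY].
  - exact: closedU.
  - by rewrite setDUr; exact: closedI.
have clpY : clp Y by split => //; rewrite setDv; exact: closed0.
have clp0 : clp set0 by split => //; [exact: closed0|rewrite setD0].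
have sepA a : Y a -> A a -> exists2 D, clp D & D a /\ D `&` B = set0.
  move=> Ya Aa; pose P := [set D | clp D /\ D a].
  pose Q := \bigcap_(D in P) D.
  have Qa : Q a by move=> D [].
  have QY : Q `<=` Y by move=> x; apply.
  have cQ : closed Q by apply: closed_bigI => D [[]].
  have small W : open W -> Q `<=` W -> exists2 D, P D & D `<=` W.
    move=> oW QW; apply: (@compact_directed _ Y _ P id W) => //.
    - by exists Y.
    - by move=> D [[]].
    - by move=> D E [cD Da] [cE Ea]; exists (D `&` E) => //; split; [exact: clpI|].
  (* a separation of [Q] would be cut by a smaller clopen set around [a] *)
  have conQ : connected Q.
    apply: contrapT => /connectedPn[E [E0 QE [sE1 sE2]]].
    have EQ b : E b `<=` Q by rewrite QE; case: b; [right|left].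
    have Ecl b : closure (E b) `&` E (~~ b) = set0.
      by case: b => //; rewrite setIC.
    have cE b : closed (E b).
      rewrite closure_id; apply/seteqP; split; first exact: subset_closure.
      move=> x cEx; have : Q x.
        by rewrite ((closure_id Q).1 cQ); exact: closureS (EQ b) _ cEx.
      have : ~ E (~~ b) x by move=> nEx; exact: (no _ x (Ecl b)).
      by rewrite QE; case: b {cEx} => /= + [].
    have [b Eb] : exists b, E b a.
      by move: Qa; rewrite QE => -[]; [exists false|exists true].
    have [|U [V [oU oV EU EV UV]]] := (@normal_openP R T).1 nT _ _ (cE b) (cE (~~ b)).
      apply/seteqP; split=> // x [Ex nEx]; apply: (no _ x (Ecl b)).
      by split=> //; exact: subset_closure.
    have [|D [cD Da] DUV] := small _ (openU oU oV).
      rewrite QE => x; case: b EU EV {Eb} => /= EU EV [Ex|Ex];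
        by [left; exact: EU|right; exact: EV].
    have DU : D `&` U = D `&` ~` V.
      apply/seteqP; split=> x [Dx Ux]; split=> //.
        by move=> Vx; exact: (no _ x UV).
      by have [] := DUV x Dx.
    have cDU : clp (D `&` U).
      case: cD => DY cD cYD; split.
      - by move=> x [/DY].
      - by rewrite DU; apply: closedI => //; exact: open_closedC.
      - rewrite setDIr.
        have -> : Y `\` D `|` Y `\` U = Y `\` D `|` (Y `&` ~` U) by rewrite (setDE Y U).
        by apply: closedU => //; apply: closedI => //; exact: open_closedC.
    have [x Ex] := E0 (~~ b).
    have [_ Ux] : (D `&` U) x by apply: (EQ _ _ Ex); split=> //; split=> //; exact: EU.
    by apply: (no _ x UV); split=> //; exact: EV.
  have QB : Q `<=` ~` B.
    move=> x Qx Bx; apply: (no _ x (AB a Ya Aa)).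
    by split=> //; exists Q.
  have [D [cD Da] DB] := small _ (closed_openC cB) QB.
  by exists D => //; split=> //; apply/disjoints_subset.
(* a finite union of clopen sets off [B] contains [A] in [Y]: the traces on [A]
   of their complements are directed and have empty intersection *)
have [D [cD DB] AD] : exists2 D, clp D /\ D `&` B = set0 & A `&` (Y `\` D) `<=` set0.
  apply: (@compact_directed _ Y _ [set D | clp D /\ D `&` B = set0]
    (fun D => A `&` (Y `\` D))) => //.
  - by exists set0; split=> //; rewrite set0I.
  - by move=> D [[_ _ cYD] _]; split; [exact: closedI|move=> x [_ []]].
  - move=> D E [cD DB] [cE EB]; exists (D `|` E).
      by split; [exact: clpU|rewrite setIUl DB EB setU0].
    by rewrite setDUr => x [Ax [YD YE]].
  - exact: open0.
  - move=> x Ix; have [Ax [Yx _]] := Ix set0 (conj clp0 (set0I _)).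
    have [D cD [Dx DB]] := sepA x Yx Ax.
    by have [_ [_]] := Ix D (conj cD DB).
case: cD => DY cD cYD; exists D, (Y `\` D); split => //.
- by rewrite setDUK.
- by rewrite setDIK.
- split=> x [Yx].
    by move=> Ax; apply: contrapT => nDx; apply: (AD x).
  by move=> Bx; split=> // Dx; exact: (no _ x DB).
Qed.

(** * Components of open sets of the plane *)

(** Balls, half-planes and the like are unions of segments from one point. *)
Lemma connected_star (A : set C) (c : C) : A c ->
  (forall z, A z -> forall t : R, 0 <= t <= 1 -> A (c + t%:C * (z - c) : R[i])) ->
  connected A.
Proof.
move=> Ac Astar.
pose seg z : set C := (fun t : R => c + t%:C * (z - c) : C) @` `[0, 1].
have segc z : seg z c.
  by exists 0; rewrite /= ?in_itv/= ?lexx ?ler01// mul0r addr0.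
have segz z : seg z z.
  by exists 1; rewrite /= ?in_itv/= ?lexx ?ler01// mul1r addrC subrK.
have -> : A = \bigcup_(z in A) seg z.
  apply/seteqP; split=> [z Az|z [y Ay [t + <-]]]; first by exists z.
  by rewrite /= in_itv /=; exact: Astar.
apply: bigcup_connected; first by exists c => z _.
move=> z _; apply: connected_continuous_connected.
  exact: segment_connected.
apply: continuous_subspaceT => t.
have h1 : (fun t : R => t%:C : C) @ t --> (t%:C : C).
  exact: (cvg_complex (FF := nbhs_filter t) cvg_id (cvg_cst 0)).
have hc (d : C) : (fun t : R => d) @ t --> d by exact: cvg_cst.
exact: (ccvgD (FF := nbhs_filter t) (hc c)
  (ccvgM (FF := nbhs_filter t) h1 (hc (z - c)))).
Qed.

Lemma connected_ball (c : C) (e : R[i]) : 0 < e -> connected (ball c e).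
Proof.
move=> e0; apply: (@connected_star _ c); first exact: ballxx.
move=> z; rewrite -!ball_normE /ball_ /= => ze t /andP[t0 t1].
rewrite opprD addrA subrr add0r normrN normrM.
apply: le_lt_trans ze; rewrite -normrN opprB -[leRHS]mul1r ler_wpM2r//.
by rewrite normcE /= expr0n addr0 sqrtr_sqr ger0_norm// lecR.
Qed.

Lemma component_open (A : set C) x : open A -> open (connected_component A x).
Proof.
move=> oA; rewrite openE => y xy.
have Ay := connected_component_sub xy.
have /nbhs_ballP[e /= e0 yeA] : nbhs y A by exact: open_nbhs_nbhs.
apply/nbhs_ballP; exists e => //= z yez.
apply: connected_component_trans xy _.
exists (ball y e) => //; split; [exact: ballxx|exact: yeA|exact: connected_ball].
Qed.

Lemma closure_component (A : set C) x : open A ->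
  closure (connected_component A x) `<=` connected_component A x `|` ~` A.
Proof.
move=> oA y cy; have [Ay|] := pselect (A y); last by right.
left; have [|z [xz yz]] := cy (connected_component A y).
  apply: open_nbhs_nbhs; split; first exact: component_open.
  exact: connected_component_refl.
by apply: connected_component_trans xz _; exact: connected_component_sym.
Qed.

Lemma connected_halfplane (w : C) (M : R) :
  connected [set z : C | M < Re (w * z : R[i])].
Proof.
have [[c Mc]|] := pselect ([set z : C | M < Re (w * z : R[i])] !=set0); last first.
  by move=> /nonemptyPn ->; exact: connected0.
apply: (@connected_star _ c) => // z /= Mz t /andP[t0 t1].
have -> : Re (w * (c + t%:C * (z - c))) =
    (1 - t) * Re (w * c : R[i]) + t * Re (w * z : R[i]).
  by clear Mc Mz; case: w c z => w1 w2 [c1 c2] [z1 z2] /=; ring.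
have [->|tn1] := eqVneq t 1; first by rewrite subrr mul0r add0r mul1r.
have t1' : 0 < 1 - t by rewrite subr_gt0 lt_neqAle tn1.
have -> : M = (1 - t) * M + t * M by ring.
by rewrite ltr_leD ?ltr_pM2l// ler_wpM2l// ltW.
Qed.

(** The complement of a square. It is used instead of the complement of a disc
because it is a union of four half-planes. *)
Definition outer (M : R) : set C :=
  [set z : C | (M < `|Re z|) || (M < `|Im z|)].

(** Consecutive half-planes among the four overlap near a corner of the square. *)
Lemma connected_outer (M : R) : connected (outer M).
Proof.
pose H w := [set z : C | M < Re (w * z : R[i])].
pose m := `|M| + 1.
have Mm : M < m by rewrite /m; have := ler_norm M; lra.
have -> : outer M = ((H 1 `|` H (0 -i* 1)) `|` H (-1)) `|` H (0 +i* 1).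
  apply/seteqP; split=> -[x y]; rewrite /outer /H /= !lter_normr; simpc => /=.
    by move=> /orP[/orP[]|/orP[]] h;
      [left; left; left|left; right|left; left; right|right]; lra.
  by move=> [[[]|]|]; lra.
have HC w : connected (H w) by exact: connected_halfplane.
apply: connectedU => //.
  by exists (m +i* (- m)); split; [left;left|]; rewrite /H /=; lra.
apply: connectedU => //.
  by exists ((-m) +i* m); split; [right|]; rewrite /H /=; lra.
apply: connectedU => //.
by exists (m +i* m); split; rewrite /H /=; lra.
Qed.

(** * Integral relations *)

(** The Smith normal form of an [N + 1] by [N] matrix has a zero last row, so the
last row of the inverse of the left unimodular factor is a relation. As a row of
an invertible integral matrix, it is not divisible by 2. *)
Lemma int_relation N (m : 'I_N.+1 -> 'I_N -> int) :
  exists k : 'I_N.+1 -> int,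
    (forall j, \sum_i k i * m i j = 0) /\ exists i, odd `|k i|%N.
Proof.
have [L uL [Q _ [d _ ME]]] := int_Smith_normal_form (\matrix_(i, j) m i j).
have [r rL] : exists r : 'rV[int]_N.+1, r *m L = row ord_max 1%:M.
  by exists (row ord_max (invmx L)); rewrite -row_mul mulVmx.
exists (fun i => r 0 i); split.
  move=> j.
  have -> : \sum_i r 0 i * m i j = (r *m (\matrix_(i, j) m i j)) 0 j.
    by rewrite mxE; apply: eq_bigr => i _; rewrite mxE.
  rewrite ME !mulmxA rL -row_mul mul1mx.
  suff -> : row ord_max (\matrix_(i < N.+1, j < N) (d`_i *+ (i == j :> nat))) = 0.
    by rewrite mul0mx mxE.
  by apply/rowP => l; rewrite !mxE /= gtn_eqF.
apply: contrapT => /forallNP even_r.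
have : (r *m L) 0 ord_max = 1 by rewrite rL !mxE eqxx.
rewrite mxE => sum1.
have : (2 %| \sum_(i < N.+1) r ord0 i * L i ord_max)%Z.
  apply: rpred_sum => i _; rewrite dvdz_mulr// dvdzE dvdn2.
  by apply/negP; exact: even_r.
by rewrite sum1.
Qed.

(** * Gluing arguments across a strip *)

Lemma arg_ofN (w : C) t : arg_of (- w) t -> arg_of w (t + pi).
Proof.
rewrite /arg_of normrN cisD cispi mulrN1 => h.
by rewrite mulrN -h opprK.
Qed.

(** On [X] the number [- w * (z - p)] has positive real part. *)
Lemma has_arg_halfplane (X : set C) (w p : C) : compact X ->
  (forall z, X z -> Re (w * z : R[i]) < Re (w * p : R[i])) ->
  has_arg X (fun z => w * (z - p) : R[i]).
Proof.
move=> cX Xp.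
have cf : continuous (fun z => - (w * (z - p) : R[i]) : C).
  move=> z.
  have h := ccvgM (FF := nbhs_filter z) (@ccvg_cst _ _ (nbhs_filter z) w)
    (ccvgB (FF := nbhs_filter z) cvg_id (@ccvg_cst _ _ (nbhs_filter z) p)).
  exact: (@cvgN _ C _ _ (nbhs_filter z) _ _ h).
have [|t ct ht] := has_arg_right cX (continuous_subspaceT cf).
  move=> z /Xp h.
  have -> : Re (- (w * (z - p)) : R[i]) = Re (w * p : R[i]) - Re (w * z : R[i]).
    by clear; case: w z p => w1 w2 [z1 z2] [p1 p2] /=; ring.
  by rewrite subr_gt0.
exists (fun z => t z + pi).
  by move=> z; exact: (cvgD (FF := nbhs_filter z) (ct z) (cvg_cst pi)).
by move=> z Xz; apply: arg_ofN; exact: ht.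
Qed.

(** Moving [p] to [q] inside [V] is a homotopy of the functions [z - p] that are
nonzero on [K]. *)
Lemma has_arg_component (K V : set C) (p q : C) : compact K -> connected V ->
  V `<=` ~` K -> V p -> V q -> has_arg K (fun z => (z - p) / (z - q) : R[i]).
Proof.
move=> cK cV VK Vp Vq.
apply: (@homotopy_has_arg C V K (fun a z => z - a) p q cV cK _ _ Vp Vq).
  by move=> a z Va Kz; apply/eqP => /subr0_eq za; apply: (VK a Va); rewrite -za.
move=> a z _ _.
have h1 : (fun q : C * C => q.2) @ (a, z) --> z by exact: cvg_snd.
have h2 : (fun q : C * C => q.1) @ (a, z) --> a by exact: cvg_fst.
exact: (ccvgB (FF := nbhs_filter (a, z)) h1 h2).
Qed.

(** A continuous function with values in a discrete set is constant on connected
sets. *)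
Lemma connected_2pi_const (A : set C) (nu : C -> R) : connected A ->
  continuous nu ->
  (forall z, A z -> exists k : int, nu z = k%:~R * (pi *+ 2)) ->
  forall x y, A x -> A y -> nu x = nu y.
Proof.
move=> cA cnu nuA; apply: connected_rel => //.
- by move=> y x z _ -> .
move=> x Ax.
have p0 : 0 < pi *+ 2 :> R by rewrite mulrn_wgt0// pi_gt0.
have := cnu x => /cvgrPdist_lt /(_ _ p0) near_x.
suff : nbhs x [set y | A y -> nu x = nu y] by [].
apply: filterS near_x => y /= + Ay.
have [k ->] := nuA x Ax; have [l ->] := nuA y Ay.
rewrite -mulrBl -rmorphB normrM (gtr0_norm p0) gtr_pMl// -intr_norm.
rewrite (_ : 1 = 1%:~R)// ltr_int => h.
suff -> : k = l by [].
apply/eqP; rewrite -subr_eq0 -normr_eq0 -[_ == 0]negbK.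
by rewrite -normr_gt0 normr_id gtz0_ge1 -ltNge.
Qed.

Lemma intr_sum (I : Type) (r : seq I) (F : I -> int) :
  (\sum_(i <- r) F i)%:~R = \sum_(i <- r) (F i)%:~R :> R.
Proof. exact: rmorph_sum. Qed.

Lemma cvg_prod (T : Type) (F : set_system T) {FF : Filter F} (I : Type)
    (s : seq I) (P : pred I) (f : I -> T -> C) (a : I -> C) :
  (forall i, P i -> f i @ F --> a i) ->
  (fun t => \prod_(i <- s | P i) f i t : C) @ F -->
    (\prod_(i <- s | P i) a i : C).
Proof.
move=> fa; elim: s => [|i s IH].
  rewrite (_ : (fun t => _) = fun=> 1); first by rewrite big_nil; exact: ccvg_cst.
  by apply/funext => t; rewrite big_nil.
rewrite (_ : (fun t => _) =
    fun t => if P i then f i t * \prod_(j <- s | P j) f j t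
             else \prod_(j <- s | P j) f j t).
  by rewrite big_cons; case: ifP => [/fa fi|_]; [exact: (ccvgM fi IH)|exact: IH].
by apply/funext => t; rewrite big_cons.
Qed.

Lemma continuous_sum (I : Type) (s : seq I) (f : I -> C -> R) :
  (forall i, continuous (f i)) -> continuous (fun z => \sum_(i <- s) f i z).
Proof.
move=> cf z; elim: s => [|i s IH].
  rewrite (_ : (fun t => _) = fun=> 0); first exact: cst_continuous.
  by apply/funext => t; rewrite big_nil.
rewrite (_ : (fun t => _) = fun t => f i t + \sum_(j <- s) f j t).
  exact: (cvgD (FF := nbhs_filter z) (cf i z) IH).
by apply/funext => t; rewrite big_cons.
Qed.

Definition strip (l : C -> R) (K : set C) (a b : R) : set C :=
  [set z | K z /\ a <= l z <= b].

Lemma closed_level_le (l : C -> R) (r : R) :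
  continuous l -> closed [set z | l z <= r].
Proof.
by move=> cl; apply: (@closed_comp _ _ l [set x | x <= r]) => //; exact: closed_le.
Qed.

Lemma closed_level_ge (l : C -> R) (r : R) :
  continuous l -> closed [set z | r <= l z].
Proof.
by move=> cl; apply: (@closed_comp _ _ l [set x | r <= x]) => //; exact: closed_ge.
Qed.

Lemma closed_strip (l : C -> R) (K : set C) (a b : R) :
  continuous l -> closed K -> closed (strip l K a b).
Proof.
move=> cl clK.
have -> : strip l K a b = K `&` ([set z | a <= l z] `&` [set z | l z <= b]).
  by apply/seteqP; split=> z [Kz] => [/andP[]|[h1 h2]]; split=> //; apply/andP.
do 2 apply: closedI => //.
  exact: closed_level_ge.
exact: closed_level_le.
Qed.

Lemma has_arg_glue (K P1 P2 : set C) (f : C -> C) (t1 t2 : C -> R) :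
  compact K -> closed P1 -> closed P2 -> K `<=` P1 `|` P2 ->
  continuous t1 -> continuous t2 ->
  (forall z, K z -> P1 z -> arg_of (f z) (t1 z)) ->
  (forall z, K z -> P2 z -> arg_of (f z) (t2 z)) ->
  (forall z, P1 z -> P2 z -> t1 z = t2 z) ->
  has_arg K f.
Proof.
move=> cK clP1 clP2 KP ct1 ct2 h1 h2 h12.
pose t z := if pselect (P1 z) then t1 z else t2 z.
have tE1 z : P1 z -> t z = t1 z by rewrite /t; case: pselect.
have tE2 z : P2 z -> t z = t2 z.
  by rewrite /t; case: pselect => //= P1z P2z; exact: h12.
have ct : {within K, continuous t}.
  apply: (continuous_subspaceW KP); apply: withinU_continuous => //.
    apply: (@subspace_eq_continuous _ _ _ t1); last exact: continuous_subspaceT.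
    by move=> z; rewrite inE => /tE1.
  apply: (@subspace_eq_continuous _ _ _ t2); last exact: continuous_subspaceT.
  by move=> z; rewrite inE => /tE2.
have [g [cg gE]] := tietze_compact cK ct.
exists g => // z Kz; rewrite -gE ?inE//.
by have [P1z|P2z] := KP z Kz; [rewrite tE1//; exact: h1|rewrite tE2//; exact: h2].
Qed.

(** Two arguments of [f] on the two parts of [K] differ on the strip by a
locally constant function [nu]. Where [nu] vanishes they agree; the set [Y]
where it does not is compact and no component of it joins the sides of the
strip. So [Y] splits into [Y1], which does not reach the side [l = b], and [Y2],
which does not reach the side [l = a]. Using the first argument on [Y1] and the
second on [Y2] avoids any conflict. *)
Lemma has_arg_glue_strip (K : set C) (l : C -> R) (a b : R) (f : C -> C)
    (t1 t2 : C -> R) :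
  compact K -> continuous l -> a < b -> (forall z, K z -> f z != 0) ->
  continuous t1 -> continuous t2 ->
  (forall z, K z -> l z <= b -> arg_of (f z) (t1 z)) ->
  (forall z, K z -> a <= l z -> arg_of (f z) (t2 z)) ->
  (forall x y, strip l K a b x -> l x <= a ->
     connected_component (strip l K a b) x y -> b <= l y -> t1 x = t2 x) ->
  has_arg K f.
Proof.
move=> cK cl ab f0 ct1 ct2 h1 h2 crossX; set X := strip l K a b in crossX *.
have hC : hausdorff_space C by exact: norm_hausdorff.
have clK : closed K by exact: compact_closed cK.
have clX : closed X by exact: closed_strip.
have cle : closed [set z | l z <= a] by exact: closed_level_le.
have cge : closed [set z | b <= l z] by exact: closed_level_ge.
pose nu z := t1 z - t2 z.
have cnu : continuous nu.
  by move=> z; exact: (cvgB (FF := nbhs_filter z) (ct1 z) (ct2 z)).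
have nuX z : X z -> exists n : int, nu z = n%:~R * (pi *+ 2).
  move=> [Kz /andP[az zb]].
  by apply: (arg_of_uniq (f0 z Kz)); [exact: h1|exact: h2].
pose Z := X `&` [set z | nu z = 0].
pose Y := X `&` [set z | nu z <> 0].
(* values of [nu] are multiples of [2 pi], so [nu] stays away from 0 on [Y],
   which makes [Y] closed *)
have nu_ge1 z : X z -> nu z <> 0 -> 1 <= `|nu z|.
  move=> /nuX[n ->] n0.
  have n1 : 1 <= `|n%:~R : R|.
    rewrite -intr_norm (_ : 1 = 1%:~R)// ler_int -gtz0_ge1 normr_gt0.
    by apply/eqP => n00; apply: n0; rewrite n00 mul0r.
  have p1 : 1 <= `|pi *+ 2 : R|.
    rewrite ger0_norm; last exact: mulrn_wge0 (pi_ge0 R).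
    rewrite mulr2n; apply: le_trans (lerD (pi_ge2 R) (pi_ge2 R)).
    by rewrite -natrD ler1n.
  by rewrite normrM -[leLHS]mulr1 ler_pM.
have clZ : closed Z.
  apply: closedI => //; apply: (@closed_comp _ _ nu [set 0]).
    by move=> z _; exact: cnu.
  exact: closed_eq.
have clY : closed Y.
  have -> : Y = X `&` [set z | 1 <= `|nu z|].
    apply/seteqP; split=> z [Xz h]; split=> //=; first exact: nu_ge1.
    by move=> /= n0; move: h; rewrite /= n0 normr0 ler10.
  apply: closedI => //.
  apply: (@closed_comp _ _ (fun z => `|nu z|) [set x | 1 <= x]).
    by move=> z _; exact: (cvg_norm (cnu z)).
  exact: closed_ge.
have cY : compact Y by apply: (subclosed_compact clY cK) => z [[]].
have [|Y1 [Y2 [clY1 clY2 Y12 Y120 [YA YB]]]] :=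
    compact_component_split hC (@normal_cplx) cY cle cge.
  move=> x [Xx nx] /= xa; rewrite -subset0 => y [xy /= yb].
  apply: nx; rewrite /= /nu (crossX x y)// ?subrr//.
  by have [B [Bx BY Bcon] By] := xy; exists B => //; split=> // u /BY[].
(* the domains of the two arguments; they meet only inside [Z] *)
pose P1 := [set z | l z <= a] `|` (Z `|` Y1).
pose P2 := [set z | b <= l z] `|` (Z `|` Y2).
have YX : Y `<=` X by move=> z [].
have Y1Y : Y1 `<=` Y by rewrite -Y12; left.
have Y2Y : Y2 `<=` Y by rewrite -Y12; right.
have no (S : set C) x : S = set0 -> ~ S x by move=> ->.
apply: (@has_arg_glue K P1 P2 f t1 t2) => //.
- by apply: closedU => //; exact: closedU.
- by apply: closedU => //; exact: closedU.
- move=> z Kz; have [za|az] := leP (l z) a; first by left; left.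
  have [bz|zb] := leP b (l z); first by right; left.
  have Xz : X z by split=> //; rewrite !ltW.
  have [n0|n0] := pselect (nu z = 0); first by left; right; left.
  have : Y z by [].
  by rewrite -Y12 => -[Y1z|Y2z]; [left|right]; right; right.
- move=> z Kz P1z; apply: h1 => //.
  case: P1z => [/= za|[[[_ /andP[]]]|/Y1Y/YX[_ /andP[]]]] //.
  exact: le_trans za (ltW ab).
- move=> z Kz P2z; apply: h2 => //.
  case: P2z => [/= bz|[[[_ /andP[]]]|/Y2Y/YX[_ /andP[]]]] //.
  exact: le_trans (ltW ab) bz.
- move=> z P1z P2z; apply/eqP; rewrite -subr_eq0; apply/eqP; rewrite -/(nu z).
  case: P1z P2z => [/= za|[[] //|Y1z]]; case=> [/= bz|[[] //|Y2z]].
  + by have := lt_le_trans ab (le_trans bz za); rewrite ltxx.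
  + by case: (no _ z Y120); split=> //; apply: YA; split=> //; exact: Y2Y.
  + by case: (no _ z Y120); split=> //; apply: YB; split=> //; exact: Y1Y.
  + by case: (no _ z Y120).
Qed.

(** All factors but one are nonzero on the closure of [V], so that they make up
the function [u] of [even_order]. *)
Lemma even_exponent (I : finType) (K V : set C) (w : C) (p : I -> C)
    (k : I -> int) (i0 : I) (M : R) :
  open V -> closure V `<=` V `|` K -> (forall z, V z -> ~ outer M z) ->
  w != 0 -> (forall i, ~ K (p i)) -> V (p i0) ->
  (forall i, i != i0 -> ~ V (p i)) ->
  has_arg K (fun z => \prod_i (w * (z - p i) : R[i]) ^ k i) ->
  ~~ odd `|k i0|%N.
Proof.
move=> oV cV Vb w0 pK Vp nVp [t ct ht].
(* the power of [w] completes [(z - p i0) ^ k i0] to the factor of index [i0] *)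
pose u z : C := w ^ k i0 * \prod_(i | i != i0) (w * (z - p i) : R[i]) ^ k i.
have zp0 i z : K z -> z - p i != 0.
  by move=> Kz; apply/eqP => /subr0_eq zp; apply: (pK i); rewrite -zp.
have zpV i z : i != i0 -> closure V z -> w * (z - p i) != 0 :> R[i].
  move=> ii0 /cV Vz; rewrite mulf_neq0//; apply/eqP => /subr0_eq zp.
  by move: Vz; rewrite zp => -[|]; [exact: nVp|exact: pK].
apply: (@even_order V (p i0) (k i0) u (4 * `|M| + 1)) => //.
- move=> z Vz.
  have small x : V x -> `|Re x| <= `|M| /\ `|Im x| <= `|M|.
    move=> /Vb /negP; rewrite negb_or -!leNgt => /andP[h1 h2].
    by split; [apply: le_trans h1 _|apply: le_trans h2 _]; exact: ler_norm.
  have [z1 z2] := small z Vz; have [p1 p2] := small _ Vp.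
  apply: le_lt_trans (normc_le _) _; rewrite !raddfB.
  apply: le_lt_trans (lerD (ler_normB _ _) (ler_normB _ _)) _.
  have := lerD (lerD z1 p1) (lerD z2 p2).
  by move=> /le_lt_trans; apply; lra.
- rewrite continuous_subspace_in => z; rewrite inE => Vz.
  have cid_ : (id : subspace (closure V) -> C) @ (z : subspace (closure V)) --> z.
    exact: (continuous_subspaceT (f := id) (fun x => cvg_id)).
  apply: ccvgM; first exact: ccvg_cst.
  apply: cvg_prod => i ii0; apply: cvg_exprz; first exact: zpV.
  by apply: ccvgM; [exact: ccvg_cst|apply: ccvgB; [exact: cid_|exact: ccvg_cst]].
- move=> z Vz; rewrite mulf_neq0 ?expfz_neq0//; apply/prodf_neq0 => i ii0.
  by rewrite expfz_neq0// zpV.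
- exists t => // z [/cV[//|Kz] _]; have := ht z Kz; rewrite (bigD1 i0)//=.
  rewrite exprMz_comm ?unitfE ?zp0//; last exact: mulrC.
  by move=> h; rewrite /u mulrCA mulrA.
Qed.

Lemma continuous_level (w : C) : continuous (fun z : C => Re (w * z : R[i])).
Proof.
move=> z.
have h := ccvgM (FF := nbhs_filter z) (@ccvg_cst _ _ (nbhs_filter z) w) cvg_id.
exact: (cvg_comp _ _ h (@continuous_Re _)).
Qed.

(** * Components of the complement that cross a strip *)

(** Each [V i] gives an integer for each of the [N] continua that join the sides
of the strip, represented by the points [c j]: the difference of the two
arguments of [w * (z - p i)] there, in units of [2 pi]. A relation between the
[N + 1] vectors of integers yields a product whose arguments glue, which
[even_exponent] excludes. *)
Lemma crossing_bound (K : set C) (w : C) (a b : R) (N : nat) (c : 'I_N -> C)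
    (V : 'I_N.+1 -> set C) (p q : 'I_N.+1 -> C) (M : R) :
  let l (z : C) := Re (w * z : R[i]) in
  let X := strip l K a b in
  compact K -> w != 0 -> a < b ->
  (forall x y, X x -> l x <= a -> connected_component X x y -> b <= l y ->
     exists j, connected_component X x (c j)) ->
  (forall i, [/\ open (V i), connected (V i), V i `<=` ~` K &
     closure (V i) `<=` V i `|` K]) ->
  (forall i z, V i z -> ~ outer M z) ->
  (forall i j, i != j -> V i `&` V j = set0) ->
  (forall i, [/\ V i (p i), b < l (p i), V i (q i) & l (q i) < a]) ->
  False.
Proof.
move=> l X cK w0 ab crossX VP Vb Vd pq.
have cl : continuous l by exact: continuous_level.
have comp A : closed A -> compact (K `&` A) by move=> cA; exact: compact_closedI.
have pK i : ~ K (p i).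
  by move=> Kp; have [_ _ VK _] := VP i; have [Vp _ _ _] := pq i; exact: (VK _ Vp).
(* arguments of [w * (z - p i)], [w * (z - q i)] and of their quotient *)
have /choice[al hal] i : exists t : C -> R, continuous t /\
    forall z, K z -> l z <= b -> arg_of (w * (z - p i) : R[i]) (t z).
  have [_ lp _ _] := pq i.
  have [|t ct ht] := @has_arg_halfplane (K `&` [set z | l z <= b])
      w (p i) (comp _ (@closed_level_le l b cl)).
    by move=> z [_ /= zb]; exact: le_lt_trans zb lp.
  by exists t; split=> // z Kz zb; exact: ht.
have /choice[be hbe] i : exists t : C -> R, continuous t /\
    forall z, K z -> a <= l z -> arg_of (w * (z - q i) : R[i]) (t z).
  have [_ _ _ lq] := pq i.
  have NE z : Re (- w * z : R[i]) = - l z by rewrite mulNr raddfN.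
  have [|t ct ht] := @has_arg_halfplane (K `&` [set z | a <= l z])
      (- w) (q i) (comp _ (@closed_level_ge l a cl)).
    by move=> z [_ /= az]; rewrite !NE ltrN2; exact: lt_le_trans lq az.
  exists (fun z => t z + pi); split.
    by move=> z; exact: (cvgD (FF := nbhs_filter z) (ct z) (cvg_cst pi)).
  by move=> z Kz az; apply: arg_ofN; rewrite -mulNr; exact: ht.
have /choice[la hla] i : exists t : C -> R, continuous t /\
    forall z, K z -> arg_of ((z - p i) / (z - q i) : R[i]) (t z).
  have [_ conV VK _] := VP i; have [Vp _ Vq _] := pq i.
  by have [t ct ht] := has_arg_component cK conV VK Vp Vq; exists t.
have zq i z : K z -> z - q i != 0.
  move=> Kz; have [_ _ VK _] := VP i; have [_ _ Vq _] := pq i.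
  by apply/eqP => /subr0_eq zq; apply: (VK _ Vq); rewrite -zq.
have zp i z : K z -> z - p i != 0.
  by move=> Kz; apply/eqP => /subr0_eq zp; apply: (pK i); rewrite -zp.
have hbl i z : K z -> a <= l z -> arg_of (w * (z - p i) : R[i]) (be i z + la i z).
  move=> Kz az; have := arg_ofM ((hbe i).2 z Kz az) ((hla i).2 z Kz).
  by rewrite -mulrA [X in w * X]mulrC divfK// zq.
pose nu i z := al i z - (be i z + la i z).
have cnu i : continuous (nu i).
  move=> z; apply: (cvgB (FF := nbhs_filter z)); first exact: (hal i).1.
  by apply: (cvgD (FF := nbhs_filter z)); [exact: (hbe i).1|exact: (hla i).1].
have nuX i z : X z -> exists k : int, nu i z = k%:~R * (pi *+ 2).
  move=> [Kz /andP[az zb]].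
  apply: (@arg_of_uniq (w * (z - p i) : R[i])); [|exact: (hal i).2|exact: hbl].
  by rewrite mulf_neq0// zp.
have nuc i j : exists n : int, X (c j) -> nu i (c j) = n%:~R * (pi *+ 2).
  have [Xc|nXc] := pselect (X (c j)); last by exists 0.
  by have [n hn] := nuX i (c j) Xc; exists n.
pose m i j := projT1 (cid (nuc i j)); have hm i j := projT2 (cid (nuc i j)).
rewrite -/(m _ _) in hm.
have [k [km [i0 ki0]]] := int_relation m.
pose t1 z := \sum_i al i z * (k i)%:~R.
pose t2 z := \sum_i (be i z + la i z) * (k i)%:~R.
have ct1 : continuous t1.
  apply: continuous_sum => i z.
  by apply: (cvgM (FF := nbhs_filter z)); [exact: (hal i).1|exact: cst_continuous].
have ct2 : continuous t2.
  apply: continuous_sum => i z.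
  apply: (cvgM (FF := nbhs_filter z)); last exact: cst_continuous.
  by apply: (cvgD (FF := nbhs_filter z)); [exact: (hbe i).1|exact: (hla i).1].
have no (S : set C) x : S = set0 -> ~ S x by move=> ->.
suff : ~~ odd `|k i0|%N by rewrite ki0.
have [oV _ VK cV] := VP i0; have [Vp _ _ _] := pq i0.
apply: (even_exponent oV cV (Vb i0) w0 pK Vp).
  move=> i ii0 Vpi; have [Vpi' _ _ _] := pq i.
  exact: (no _ (p i) (Vd i i0 ii0)).
apply: (has_arg_glue_strip cK cl ab _ ct1 ct2).
- by move=> z Kz; apply/prodf_neq0 => i _; rewrite expfz_neq0// mulf_neq0// zp.
- by move=> z Kz zb; apply: arg_of_prod => i; apply: arg_ofXz; exact: (hal i).2.
- by move=> z Kz az; apply: arg_of_prod => i; apply: arg_ofXz; exact: hbl.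
- move=> x y Xx xa xy yb; have [j xc] := crossX x y Xx xa xy yb.
  have nu_x i : nu i x = (m i j)%:~R * (pi *+ 2).
    rewrite -hm; last exact: connected_component_sub xc.
    apply: (@connected_2pi_const (connected_component X x)) => //.
    + exact: component_connected.
    + by move=> z /connected_component_sub; exact: nuX.
    + exact: connected_component_refl.
  apply/eqP; rewrite -subr_eq0 -sumrB; apply/eqP.
  under eq_bigr do rewrite -mulrBl -/(nu _ _) nu_x mulrAC -intrM [_ * k _]mulrC.
  by rewrite -mulr_suml -intr_sum km mul0r.
Qed.

Lemma near_notin_finite (A : set nat) : finite_set A -> \forall n \near \oo, ~ A n.
Proof.
move=> /finite_seqP[s ->]; exists (\max_(i <- s) i).+1 => // n /= sn ns.
have : (n <= \max_(i <- s) i)%N by apply: (@leq_bigmax_seq _ s xpredT id).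
by rewrite leqNgt sn.
Qed.

Definition crossing (w : C) (a b : R) (A : set C) : Prop :=
  (exists2 x, A x & Re (w * x : R[i]) < a) /\
  (exists2 y, A y & b < Re (w * y : R[i])).

Lemma Re_mul_le_normc (w : C) (x : C) : Normc.normc w = 1 ->
  Re (w * x : R[i]) <= Normc.normc x.
Proof.
move=> w1; rewrite -[leRHS]mul1r -w1 -Normc.normcM.
by apply: le_trans (Re_le_normc _); exact: ler_norm.
Qed.

Lemma meeting_components (A : set C) (U : nat -> set C) (m n : nat) (z : C) :
  set_bij [set: nat] (components A) U -> U m z -> U n z -> m = n.
Proof.
move=> [Ucomp Uinj _].
have [x _ Um] := Ucomp m I; have [y _ Un] := Ucomp n I.
rewrite -Um -Un => xz yz.
have /Uinj : U m = U n.
  by rewrite -Um -Un (same_connected_component xz) (same_connected_component yz).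
by rewrite !inE; exact.
Qed.

(** The components of [K] in the strip that join its sides form a family to
which the finitely Suslinian property applies; [crossing_bound] bounds the
number of crossing components of the complement by the size of this family. *)
Lemma finite_crossing (K : set C) (U : nat -> set C) (w : C) (a b M : R) :
  finitely_suslinian K -> set_bij [set: nat] (components (~` K)) U ->
  Normc.normc w = 1 -> a < b ->
  finite_set [set n | (forall z, U n z -> ~ outer M z) /\ crossing w a b (U n)].
Proof.
move=> [cK suslinK] hU w1 ab; have [Ucomp _ _] := hU.
have hC : hausdorff_space C by exact: norm_hausdorff.
have clK : closed K by exact: compact_closed cK.
have w0 : w != 0.
  by apply/eqP => w0; move: w1; rewrite w0 Normc.normc0 => /esym/eqP; rewrite oner_eq0.
pose l (z : C) := Re (w * z : R[i]).
pose X := strip l K a b.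
have cl : continuous l by exact: continuous_level.
have clX : closed X by exact: closed_strip.
(* the components of [K] in the strip that join its sides *)
pose F := [set A | exists x y, [/\ X x, l x <= a, b <= l y, A y &
  A = connected_component X x]].
have finF : finite_set F.
  apply: suslinK.
  - move=> _ [x [y [_ _ _ _ ->]]].
    have sub : connected_component X x `<=` K by move=> z /connected_component_sub[].
    split=> //; split; last exact: component_connected.
    by apply: (subclosed_compact _ cK sub); exact: component_closed.
  - move=> _ _ [x [_ [_ _ _ _ ->]]] [x' [_ [_ _ _ _ ->]]] [z [xz x'z]].
    by rewrite (same_connected_component xz) (same_connected_component x'z).
  - exists (b - a); first by rewrite subr_gt0.
    move=> A [x [y [Xx xa yb + AE]]]; rewrite AE => xy.
    apply: (@le_trans _ _ (Normc.normc (y - x))%:E).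
      rewrite lee_fin; apply: le_trans (Re_mul_le_normc _ w1).
      by rewrite mulrBr raddfB lerB.
    apply: ereal_sup_ubound; exists (y, x) => //; split=> //=.
    exact: connected_component_refl.
have [s Fs] := (finite_seqP F).1 finF.
pose c (j : 'I_(size s)) : C := get (nth set0 s j).
apply: contrapT => /infiniteP/pcard_leP[e].
have eP i : (forall z, U (e i) z -> ~ outer M z) /\ crossing w a b (U (e i)).
  exact: (@funS _ _ _ _ e i I).
have UE i : exists2 x, ~ K x & U (e i) = connected_component (~` K) x.
  by have [x Kx <-] := Ucomp (e i) I; exists x.
have [p hp] := choice (fun i => let: ex_intro2 y Uy h := (eP i).2.2 in
  ex_intro (fun y => U (e i) y /\ b < l y) y (conj Uy h)).
have [q hq] := choice (fun i => let: ex_intro2 y Uy h := (eP i).2.1 in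
  ex_intro (fun y => U (e i) y /\ l y < a) y (conj Uy h)).
apply: (@crossing_bound K w a b (size s) c (fun i => U (e i)) p q M cK w0 ab) => //.
- move=> x y Xx xa xy yb.
  have Fx : F (connected_component X x) by exists x, y.
  have xs : connected_component X x \in s by move: Fx; rewrite Fs.
  have xi : (index (connected_component X x) s < size s)%N by rewrite index_mem.
  exists (Ordinal xi); rewrite /c /= nth_index//.
  by apply: getPex; exists x; exact: connected_component_refl.
- move=> i; have [x Kx ->] := UE i; split.
  + exact/component_open/closed_openC.
  + exact: component_connected.
  + exact: connected_component_sub.
  + by move=> z /(closure_component (closed_openC clK)); rewrite setCK.
- by move=> i z; exact: (eP i).1.
- move=> i j ij; rewrite -subset0 => z [iz jz].
  move: (meeting_components hU iz jz).
  move=> /(@inj _ _ _ e); rewrite !inE => /(_ I I) /ord_inj ij'.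
  by rewrite ij' eqxx in ij.
- by move=> i; have [] := hp i; have [] := hq i.
Qed.

(** A set that spreads over more than three steps of a grid crosses a cell of
it, and finitely many cells meet the interval [[- M, M]]. *)
Lemma long_crossing (M e : R) : 0 < e ->
  exists L : nat, forall (A : set C) (w x y : C),
    A x -> A y -> `|Re (w * x : R[i])| <= M ->
    `|Re (w * y : R[i])| <= M -> 3 * e < Re (w * y : R[i]) - Re (w * x : R[i]) ->
    exists2 k, (k < L)%N & crossing w (k%:R * e - M) (k.+1%:R * e - M) A.
Proof.
move=> e0; exists (Num.truncn (2 * M / e)).+2 => A w x y Ax Ay.
set lx := Re (w * x : R[i]); set ly := Re (w * y : R[i]).
rewrite !ler_norml => /andP[x1 x2] /andP[y1 y2] xy.
pose t := (lx + M) / e.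
have t0 : 0 <= t by apply: divr_ge0; [lra|exact: ltW].
have te : t * e = lx + M by rewrite divfK// gt_eqF.
have /andP[kt tk] := truncn_itv t0; exists (Num.truncn t).+1.
  rewrite !ltnS; apply: le_truncn; rewrite ler_pM2r ?invr_gt0//; lra.
have ke : (Num.truncn t)%:R * e <= lx + M by rewrite -te ler_pM2r.
have ek : lx + M < (Num.truncn t).+1%:R * e by rewrite -te ltr_pM2r.
split; [exists x => //|exists y => //]; rewrite -/lx -/ly; first lra.
move: ek; rewrite -!natr1 !mulrDl mul1r; lra.
Qed.

End plane.

Theorem theorem4p1 (R : realType) (K : set (cplx R)) (U : nat -> set (cplx R))
    (hK : finitely_suslinian K)
    (hU : set_bij [set: nat] (components (~` K)) U) :
  diam (U n) @[n --> \oo] --> (0 : R)%:E.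
Proof.
have [cK _] := hK; have [Ucomp _ _] := hU.
have [M KM] : exists M : R, outer M `<=` ~` K.
  have bnd (f : cplx R -> R) : continuous f -> exists M : R, forall z, K z -> `|f z| <= M.
    move=> cf; have := continuous_compact (continuous_subspaceT cf) cK.
    move=> /compact_bounded[B [_ HB]].
    by exists (B + 1) => z Kz; apply: HB; [rewrite ltrDl|exists z].
  have [M1 h1] := bnd _ (@continuous_Re R); have [M2 h2] := bnd _ (@continuous_Im R).
  exists (Num.max M1 M2) => z /= /orP[] h Kz; move: h; rewrite gt_max.
    by rewrite ltNge h1.
  by rewrite [X in _ && X]ltNge h2// andbF.
have UE n : exists2 x, ~ K x & U n = connected_component (~` K) x.
  by have [x Kx <-] := Ucomp n I; exists x.
(* all the components that reach far out contain the connected set [outer M] *)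
have unb : finite_set [set n | exists2 z, U n z & outer M z].
  have [[n0 hn0]|none] := pselect (exists n, exists2 z, U n z & outer M z); last first.
    rewrite (_ : mkset _ = set0) ?finite_set0//.
    by rewrite -subset0 => n hn; apply: none; exists n.
  apply: (@sub_finite_set _ _ [set n0]); last exact: finite_set1.
  have outerU n : (exists2 z, U n z & outer M z) -> outer M `<=` U n.
    have [x _ ->] := UE n; move=> [z xz Mz] y My.
    apply: connected_component_trans xz _.
    by exists (outer M) => //; split=> //; exact: connected_outer.
  move=> n hn /=; have [z0 Uz0 Mz0] := hn0.
  exact: (meeting_components hU (outerU _ hn _ Mz0) Uz0).
have big (e : R) : 0 < e -> finite_set [set n | (e%:E <= diam (U n))%E].
  move=> e0.
  (* two points at distance more than [e / 2] differ by more than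
     [e / 4 = 3 * d] in one of the coordinates *)
  pose d := e / 12; have d0 : 0 < d by rewrite divr_gt0.
  have [L HL] := long_crossing M d0.
  (* multiplication by [ws b] turns [Re] into [Re] or [Im] *)
  pose ws (b : bool) : cplx R := if b then 1 else 0 -i* 1.
  apply: (@sub_finite_set _ _ ([set n | exists2 z, U n z & outer M z] `|`
    \bigcup_(b in [set: bool]) \bigcup_(k in `I_L)
     [set n | (forall z, U n z -> ~ outer M z) /\
       crossing (ws b) (k%:R * d - M) (k.+1%:R * d - M) (U n)])).
    move=> n /= en; have [|nb] := pselect (exists2 z, U n z & outer M z); first by left.
    right.
    have nbn z : U n z -> ~ outer M z by move=> Uz Oz; apply: nb; exists z.
    have [_ [[x y] /= [Ux Uy] <-]] : exists2 r,
        [set (Normc.normc (p.1 - p.2))%:E | p in U n `*` U n] r &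
        ((e / 2)%:E < r)%E.
      by apply: ereal_sup_gt; apply: lt_le_trans en; rewrite lte_fin; lra.
    rewrite lte_fin => exy.
    have small z : U n z -> `|complex.Re z| <= M /\ `|complex.Im z| <= M.
      by move=> /nbn /negP; rewrite negb_or -!leNgt => /andP.
    have wE b z : complex.Re (ws b * z : R[i]) = if b then complex.Re z else complex.Im z.
      by case: b z => -[z1 z2] /=; ring.
    have wM b z : U n z -> `|complex.Re (ws b * z : R[i])| <= M.
      by move=> /small[]; rewrite wE; case: b.
    have [b hb] : exists b,
        3 * d < `|complex.Re (ws b * x : R[i]) - complex.Re (ws b * y : R[i])|.
      have := lt_le_trans exy (normc_le _); rewrite !raddfB => h.
      have [h1|h1] := ltP (3 * d) `|complex.Re x - complex.Re y|.
        by exists true; rewrite !wE.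
      exists false; rewrite !wE; rewrite /d in h1 *; lra.
    exists b => //; move: hb; rewrite lter_normr opprB => /orP[] h.
      have [k kL ck] := HL (U n) _ y x Uy Ux (wM b _ Uy) (wM b _ Ux) h.
      by exists k.
    have [k kL ck] := HL (U n) _ x y Ux Uy (wM b _ Ux) (wM b _ Uy) h.
    by exists k.
  rewrite finite_setU; split=> //.
  apply: bigcup_finite; first exact: finite_finset.
  move=> b _; apply: bigcup_finite; first exact: finite_II.
  move=> k _; apply: (finite_crossing M hK hU).
    by case: b; rewrite /= !(expr1n, expr0n, sqrrN, addr0, add0r) sqrtr1.
  by rewrite ltrD2r ltr_pM2r// ltr_nat.
have diam_ge0 n : (0 <= diam (U n))%E.
  have [x Kx Ux] := UE n; apply: ereal_sup_ubound; exists (x, x).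
    by split; rewrite /= Ux; exact: connected_component_refl.
  by rewrite /= subrr Normc.normc0.
have small (e : R) : 0 < e -> \forall n \near \oo, (diam (U n) < e%:E)%E.
  move=> /big /near_notin_finite; apply: filterS => n /negP.
  by rewrite -ltNge.
have fin : \forall n \near \oo, diam (U n) \is a fin_num.
  apply: filterS (small 1 ltr01) => n h.
  by rewrite ge0_fin_numE// (lt_trans h)// ltry.
apply/fine_cvgP; split=> //; apply/cvgrPdist_lt => e e0.
near=> n; rewrite sub0r normrN ger0_norm ?fine_ge0//.
rewrite -lte_fin fineK; first by near: n; exact: small.
by near: n.
Unshelve. all: end_near. Qed.
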